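(* Let $\{P_\theta:\theta\in\Theta\}$ be a family of probability distributions dominated by a common measure $\mu$, with densities $p_\theta=dP_\theta/d\mu$, and assume $\Theta$ is totally bounded under $\mathsf{TV}$. Let $\epsilon\in[0,1]$, $\delta>0$, and let $\hat\theta$ be the pairwise-tournament estimator (defined in the context) built from a $\delta$-covering set $\{\theta_1,\dots,\theta_m\}\subset\Theta$ with $m=\mathcal{M}(\delta,\Theta,\mathsf{TV}(\cdot,\cdot))$, based on $n$ i.i.d. observations $X_1,\dots,X_n$. If $\eta>8(\epsilon+\delta)$, then $$\sup_{\theta\in\Theta,Q}\mathbb{P}_{(\epsilon,\theta,Q)}\left\{\mathsf{TV}(P_{\hat\theta},P_\theta)>\eta+\delta\right\}\leq 4\mathcal{M}^2(\delta,\Theta,\mathsf{TV}(\cdot,\cdot))\exp\left(-\frac12 n\left(\frac{\eta}{4}-2(\epsilon+\delta)\right)^2\right),$$ where $Q$ ranges over all probability distributions.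
   Context: $\mathsf{TV}(P_1,P_2)=\sup_B|P_1(B)-P_2(B)|$ is the total variation distance. $\mathbb{P}_{(\epsilon,\theta,Q)}$ is the law under which $X_1,\dots,X_n$ are i.i.d. from $(1-\epsilon)P_\theta+\epsilon Q$. A finite set $\{\theta_1,\dots,\theta_m\}\subset\Theta$ is a $\delta$-covering set if for every $\theta\in\Theta$ there is $j\in\{1,\dots,m\}$ with $\mathsf{TV}(P_{\theta_j},P_\theta)\le\delta$; the covering number $\mathcal{M}(\delta,\Theta,\mathsf{TV}(\cdot,\cdot))$ is the smallest $m$ for which such a set exists. Tournament estimator: for $j\ne k$ let $$\phi_{jk}=\mathbb{I}\left\{\left|\tfrac1n\textstyle\sum_{i=1}^n\mathbb{I}\{p_{\theta_j}(X_i)>p_{\theta_k}(X_i)\}-P_{\theta_j}(p_{\theta_j}(X)>p_{\theta_k}(X))\right|>\left|\tfrac1n\textstyle\sum_{i=1}^n\mathbb{I}\{p_{\theta_j}(X_i)>p_{\theta_k}(X_i)\}-P_{\theta_k}(p_{\theta_j}(X)>p_{\theta_k}(X))\right|\right\},$$ where $P_{\theta}(p_{\theta_j}(X)>p_{\theta_k}(X))$ is the probability of the event under $X\sim P_{\theta}$. Then $\hat\theta=\theta_{\hat j}$ with $\hat j\in\arg\min_{1\le j\le m}\sum_{k\ne j}\phi_{jk}$, where any minimizer may be chosen. *)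

(* Defs.v *)
From HB Require Import structures.
From mathcomp Require Import all_boot all_order all_algebra.
From mathcomp Require Import all_classical all_reals all_analysis.
Import Order.TTheory GRing.Theory Num.Theory.
Import numFieldNormedType.Exports.
Set Implicit Arguments.
Unset Strict Implicit.
Unset Printing Implicit Defensive.
Local Open Scope classical_set_scope.
Local Open Scope ring_scope.

Definition TV (d : measure_display) (T : measurableType d) (R : realType)
    (P1 P2 : probability T R) : R :=
  sup [set `|fine (P1 B) - fine (P2 B)| | B in @measurable d T].

Section contamination.
Context {d : measure_display} {T : measurableType d} {R : realType}.
Variables (eps : {i01 R}) (P Q : probability T R).

(* Huber's contamination model: the mixture (1 - eps) P + eps Q *)
Definition contamination : set T -> \bar R :=
  measure_add (mscale (1 - eps%:num)%:nng P) (mscale eps%:num%:nng Q).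

Lemma contaminationE A :
  contamination A = ((1 - eps%:num)%:E * P A + eps%:num%:E * Q A)%E.
Proof. by rewrite /contamination measure_addE. Qed.

HB.instance Definition _ := Measure.on contamination.

Let contamination_setT : contamination [set: T] = 1%E.
Proof. by rewrite contaminationE !probability_setT !mule1 -EFinD subrK. Qed.

HB.instance Definition _ :=
  Measure_isProbability.Build _ _ _ contamination contamination_setT.

End contamination.

Section iid.
Context {d : measure_display} {T : measurableType d} {R : realType}.

Definition tuple_cons n (z : T * n.-tuple T) : n.+1.-tuple T :=
  [tuple of z.1 :: z.2].

Lemma measurable_tuple_cons n : measurable_fun [set: _] (@tuple_cons n).
Proof. exact: measurable_cons. Qed.

HB.instance Definition _ n :=
  isMeasurableFun.Build _ _ _ _ (@tuple_cons n) (@measurable_tuple_cons n).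

(* joint law of n i.i.d. observations drawn from P, i.e. the n-fold product
   of P on n.-tuple T with the sigma-algebra generated by the coordinates *)
Fixpoint iid_law (P : probability T R) (n : nat) : probability (n.-tuple T) R :=
  match n with
  | 0%N => dirac ([tuple] : 0.-tuple T)
  | n'.+1 => distribution (P \x iid_law P n')%E (@tuple_cons n')
  end.

(* this property characterizes iid_law P n, boxes being a generating
   pi-system *)
Lemma iid_law_box (P : probability T R) (n : nat) (A : 'I_n -> set T) :
  (forall i, measurable (A i)) ->
  iid_law P n [set x | forall i, A i (tnth x i)] = (\prod_(i < n) P (A i))%E.
Proof.
elim: n A => [|n ih] A mA.
  rewrite big_ord0 /= diracE mem_set//=.
  by case.
rewrite big_ord_recl -(ih (fun i => A (lift ord0 i))) /=; last first.
  by move=> i; exact: mA.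
rewrite /distribution /pushforward -product_measure1E//=.
- congr (_ _); apply/seteqP; split => [[x t] /= h|[x t] /= [h0 h] i].
    split; first by have := h ord0; rewrite tnth0.
    by move=> i; have := h (lift ord0 i); rewrite tnthS.
  case: (unliftP ord0 i) => [j ->|->]; first by rewrite tnthS.
  by rewrite tnth0.
- rewrite [X in measurable X](_ : _ =
    \bigcap_(i in [set: 'I_n]) ((@tnth n T ^~ i) @^-1` A (lift ord0 i))).
    apply: fin_bigcap_measurable => // i _.
    rewrite -[X in measurable X]setTI.
    exact: measurable_tnth.
  by apply/seteqP; split => [x h i _|x h i]; apply: h.
Qed.

End iid.

Section covering.
Context {d : measure_display} {T : measurableType d} {R : realType}
  {Theta : Type}.
Variable P : Theta -> probability T R.

Definition is_covering (delta : R) (m : nat) (c : 'I_m -> Theta) : Prop :=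
  forall theta, exists j, TV (P (c j)) (P theta) <= delta.

Definition has_covering (delta : R) (m : nat) : Prop :=
  exists c : 'I_m -> Theta, is_covering delta c.

Definition TV_totally_bounded : Prop :=
  forall delta : R, 0 < delta -> exists m, has_covering delta m.

(* the default value 0 is used only when there is no finite covering *)
Definition covering_number (delta : R) : nat :=
  xget 0%N [set m | has_covering delta m /\
                    forall k, has_covering delta k -> (m <= k)%N].

End covering.

Definition is_density (d : measure_display) (T : measurableType d)
    (R : realType) (mu : {measure set T -> \bar R}) (P : probability T R)
    (p : T -> R) : Prop :=
  [/\ measurable_fun [set: T] p, (forall x, 0 <= p x)
    & forall A, measurable A -> P A = (\int[mu]_(x in A) (p x)%:E)%E].

Section tournament.
Context {d : measure_display} {T : measurableType d} {R : realType}
  {Theta : Type}.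
Variables (P : Theta -> probability T R) (p : Theta -> T -> R).

Definition empirical n (x : n.-tuple T) (A : set T) : R :=
  n%:R^-1 * \sum_(i < n) \1_A (tnth x i).

Definition test_set (theta theta' : Theta) : set T :=
  [set y | p theta y > p theta' y].

Variables (m : nat) (c : 'I_m -> Theta).

Definition phi n (x : n.-tuple T) (j k : 'I_m) : bool :=
  let A := test_set (c j) (c k) in
  `|empirical x A - fine (P (c j) A)| > `|empirical x A - fine (P (c k) A)|.

Definition losses n (x : n.-tuple T) (j : 'I_m) : nat :=
  (\sum_(k < m | k != j) phi x j k)%N.

(* jhat selects, measurably in the sample, one of the minimizers; the
   estimator is then c \o jhat *)
Definition is_tournament n (jhat : n.-tuple T -> 'I_m) : Prop :=
  (forall j, measurable (jhat @^-1` [set j])) /\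
  (forall x j, (losses x (jhat x) <= losses x j)%N).

End tournament.

(* Main.v *)
Require Import Defs.
From mathcomp Require Import all_boot all_order all_algebra.
From mathcomp Require Import all_classical all_reals all_analysis.
From mathcomp Require Import measurable_realfun ring lra.
Import Order.TTheory GRing.Theory Num.Theory.
Import numFieldNormedType.Exports.
Set Implicit Arguments.
Unset Strict Implicit.
Unset Printing Implicit Defensive.
Local Open Scope classical_set_scope.
Local Open Scope ring_scope.

(** Write X for the contaminated law of one observation, A_jk for the set
where p_(theta_j) > p_(theta_k), and r = eta / 8.  The estimator only looks at
the empirical frequencies of the m^2 sets A_jk, and the argument separates
chance from combinatorics.

Chance.  Put t = eta / 8 - (eps + delta), which is nonnegative by the
assumption on eta.  By Hoeffding's inequality ([hoeffding]) the empirical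
frequency of one fixed A_jk is off its X-probability by more than t with
probability at most 2 exp(-2 n t^2); since t is half of
eta / 4 - 2 (eps + delta), the exponent is the announced one, and a union bound
over the pairs (j, k) gives 2 m^2 exp(...), half of what is claimed.
Hoeffding's inequality is Chernoff's bound ([chernoff_hits]) combined with the
estimate 1 - q + q exp(l) <= exp(l q + l^2 / 8) for the moment generating
function of a Bernoulli variable ([bernoulli_mgf_le]).

Combinatorics.  Off this exceptional event, let theta_j0 be a centre of the
covering within delta of the true theta.  As X is within eps of P_theta, every
empirical frequency is within t + eps + delta = r of its P_(theta_j0)
probability.  By Scheffe's identity ([TV_scheffe]) the set A_jk witnesses the
whole distance between P_(theta_j) and P_(theta_k), so that
- theta_j0 can lose only against centres within 2 r of it, whereas
- a centre farther than 8 r from theta_j0 loses against all centres within 2 r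
  of theta_j0, among them theta_j0 itself.
Such a far centre therefore loses strictly more often than theta_j0 and cannot
be a minimizer ([TV_tournament]): the selected centre is within 8 r = eta of
theta_j0, hence within eta + delta of theta. *)

(** * The moment generating function of a Bernoulli variable *)

Lemma nondecreasing_from0 (R : realType) (f df : R -> R) :
  (forall x : R, 0 <= x -> is_derive x 1 f (df x)) ->
  (forall x : R, 0 <= x -> 0 <= df x) ->
  forall x : R, 0 <= x -> f 0 <= f x.
Proof.
move=> fdf df0 x x0.
apply: (@ger0_derive1_ndecry R f 0) => // [y|y|].
- by rewrite in_itv/= andbT => /ltW /fdf[].
- rewrite in_itv/= andbT => /ltW y0.
  by rewrite derive1E (@derive_val _ _ _ _ _ _ _ (fdf _ y0)) df0.
- apply: derivable_within_continuous => y.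
  by rewrite in_itv/= andbT => /fdf[].
Qed.

Lemma bernoulli_mgf_gt0 (R : realType) (q l : R) :
  0 <= q <= 1 -> 0 < 1 - q + q * expR l.
Proof.
move=> /andP[q0 q1]; have := expR_gt0 l; move: (expR l) => e e0.
have [->|q0'] := eqVneq q 0; first by lra.
have : 0 < q * e by rewrite mulr_gt0// lt0r q0'.
lra.
Qed.

(** The variance of a variable with values in {0, 1} is at most 1/4 under every
exponential tilting: as a function of l, the logarithm F of the ratio of the
right side to the left one satisfies F 0 = F' 0 = 0 and F'' >= 0, the last
inequality being 4 u v <= (u + v)^2 for the two weights u = 1 - q and
v = q exp(l). *)
Lemma bernoulli_mgf_le (R : realType) (q l : R) : 0 <= q <= 1 -> 0 <= l ->
  1 - q + q * expR l <= expR (l * q + l ^+ 2 / 8).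
Proof.
move=> q01 l0; rewrite -ler_ln ?posrE ?expR_gt0 ?bernoulli_mgf_gt0// expRK.
pose D (x : R) := 1 - q + q * expR x.
have D0 x : 0 < D x := bernoulli_mgf_gt0 x q01.
have DD (x : R) : is_derive x 1 D (q * expR x).
  rewrite /D; apply: is_derive_eq; rewrite ?scaler0; rewrite /GRing.scale/=; ring.
pose F1 (x : R) := q + x / 4 - q * expR x / D x.
pose F (x : R) := x * q + x ^+ 2 / 8 - ln (D x).
have dF (x : R) : is_derive x 1 F (F1 x).
  have ? := is_derive1_comp (is_derive1_ln (D0 x)) (DD x).
  rewrite /F; apply: is_derive_eq.
  rewrite /F1 ?scaler0 /GRing.scale/=; field.
  by rewrite gt_eqF.
have dF1 (x : R) : is_derive x 1 F1 (4^-1 - (1 - q) * (q * expR x) / D x ^+ 2).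
  have Dx : D x != 0 by rewrite gt_eqF.
  have ? := is_deriveV Dx.
  rewrite /F1; apply: is_derive_eq.
  rewrite ?scaler0 /GRing.scale/=; move: Dx; rewrite /D => Dx; field.
  exact: Dx.
rewrite -subr_ge0.
have F0 : F 0 = 0 by rewrite /F /D expR0 mulr1 subrK ln1; field.
have F10 : F1 0 = 0 by rewrite /F1 /D expR0 mulr1 subrK; field.
rewrite -[X in X <= _]F0; apply: (nondecreasing_from0 (fun x _ => dF x)) => // x x0.
rewrite -[X in X <= _]F10; apply: (nondecreasing_from0 (fun x _ => dF1 x)) => // y y0.
rewrite subr_ge0 ler_pdivrMr ?exprn_gt0//.
rewrite -subr_ge0.
have -> : 4^-1 * D y ^+ 2 - (1 - q) * (q * expR y) =
    4^-1 * (1 - q - q * expR y) ^+ 2.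
  by rewrite /D; field.
by rewrite mulr_ge0// sqr_ge0.
Qed.

(** * Total variation *)

Lemma measurable_fun_lt_set d (T : measurableType d) (R : realType) (f g : T -> R) :
  measurable_fun [set: T] f -> measurable_fun [set: T] g ->
  measurable [set x | f x < g x].
Proof.
move=> mf mg; rewrite -[X in measurable X]setTI.
exact: (measurable_fun_ltr mf mg measurableT).
Qed.

Section probability_values.
Context {d : measure_display} {T : measurableType d} {R : realType}.
Implicit Types (P Q : probability T R) (A B : set T).

Lemma probE P A : measurable A -> P A = (fine (P A))%:E.
Proof. by move=> mA; rewrite fineK// fin_num_measure. Qed.

Lemma prob_ge0 P A : 0 <= fine (P A).
Proof. exact: fine_ge0. Qed.

Lemma prob_le1 P A : measurable A -> fine (P A) <= 1.
Proof. by move=> mA; rewrite -lee_fin -probE// probability_le1. Qed.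

Lemma probC P A : measurable A -> fine (P (~` A)) = 1 - fine (P A).
Proof. by move=> mA; rewrite probability_setC// (probE P mA). Qed.

Lemma prob_split P A B : measurable A -> measurable B ->
  fine (P A) = fine (P (A `&` B)) + fine (P (A `\` B)).
Proof.
move=> mA mB; rewrite -fineD ?fin_num_measure//; last 2 first.
- exact: measurableI.
- exact: measurableD.
by congr fine; rewrite addeC (measureDI _ mA mB).
Qed.

Lemma TV_ge P Q A : measurable A -> `|fine (P A) - fine (Q A)| <= TV P Q.
Proof.
move=> mA; apply: ub_le_sup; last by exists A.
exists 1 => _ [B mB <-].
have := prob_ge0 P B; have := prob_ge0 Q B.
have := prob_le1 P mB; have := prob_le1 Q mB.
rewrite ler_norml => *; apply/andP; split; lra.
Qed.

Lemma TV_le P Q (b : R) :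
  (forall A, measurable A -> `|fine (P A) - fine (Q A)| <= b) -> TV P Q <= b.
Proof.
move=> h; apply: ge_sup => [|_ [A mA <-]]; last exact: h.
by exists `|fine (P set0) - fine (Q set0)|, set0.
Qed.

Lemma TVC P Q : TV P Q = TV Q P.
Proof. by congr sup; apply: eq_imagel => A _; rewrite distrC. Qed.

Lemma TV_triangle P1 P2 P3 : TV P1 P3 <= TV P1 P2 + TV P2 P3.
Proof.
apply: TV_le => A mA; rewrite (le_trans (ler_distD (fine (P2 A)) _ _))//.
by rewrite lerD// TV_ge.
Qed.

Lemma TV_contamination (eps : {i01 R}) P Q :
  TV (contamination eps P Q) P <= eps%:num.
Proof.
apply: TV_le => A mA.
have -> : fine (contamination eps P Q A) =
    (1 - eps%:num) * fine (P A) + eps%:num * fine (Q A).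
  by rewrite /= contaminationE (probE P mA) (probE Q mA).
have -> : (1 - eps%:num) * fine (P A) + eps%:num * fine (Q A) - fine (P A) =
  eps%:num * (fine (Q A) - fine (P A)) by ring.
rewrite normrM ger0_norm// ler_piMr// ler_norml.
have := prob_ge0 P A; have := prob_ge0 Q A.
have := prob_le1 P mA; have := prob_le1 Q mA.
by move=> *; apply/andP; split; lra.
Qed.

End probability_values.

(** * Scheffe's identity *)

Section scheffe.
Context {d : measure_display} {T : measurableType d} {R : realType}.
Variable mu : {measure set T -> \bar R}.
Implicit Types (P Q : probability T R) (p q : T -> R).

Lemma measurable_density_lt P Q p q : is_density mu P p -> is_density mu Q q ->
  measurable [set y | q y < p y].
Proof.
move=> [mp _ _] [mq _ _].
exact: measurable_fun_lt_set mq mp.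
Qed.

Lemma le_prob_of_density P Q p q A : is_density mu P p -> is_density mu Q q ->
  measurable A -> (forall x, A x -> p x <= q x) ->
  fine (P A) <= fine (Q A).
Proof.
move=> [mp p0 PE] [mq q0 QE] mA pq.
rewrite -lee_fin -!probE// PE// QE//; apply: ge0_le_integral => //.
- by move=> x _; rewrite lee_fin.
- by apply/measurable_EFinP; apply: measurable_funS mp.
- by apply/measurable_EFinP; apply: measurable_funS mq.
Qed.

(** Cutting an event B along S = {q < p} can only increase P - Q: outside S the
difference is nonpositive, and on S it is nonnegative.  Complementing B turns
this into a bound on Q - P by the same quantity. *)
Lemma TV_scheffe P Q p q : is_density mu P p -> is_density mu Q q ->
  TV P Q <= fine (P [set y | q y < p y]) - fine (Q [set y | q y < p y]).
Proof.
move=> Pp Qq; set S := [set y | q y < p y].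
have mS : measurable S := measurable_density_lt Pp Qq.
have H B : measurable B -> fine (P B) - fine (Q B) <= fine (P S) - fine (Q S).
  move=> mB.
  rewrite (prob_split P mB mS) (prob_split Q mB mS).
  rewrite (prob_split P mS mB) (prob_split Q mS mB) (setIC S B).
  have : fine (P (B `\` S)) <= fine (Q (B `\` S)).
    apply: (le_prob_of_density Pp Qq); first exact: measurableD.
    by move=> x [_ /negP]; rewrite -leNgt.
  have : fine (Q (S `\` B)) <= fine (P (S `\` B)).
    apply: (le_prob_of_density Qq Pp); first exact: measurableD.
    by move=> x [/ltW].
  by move=> ? ?; lra.
apply: TV_le => A mA; rewrite ler_norml; apply/andP; split; last exact: H.
have := H _ (measurableC mA).
by rewrite !probC//; lra.
Qed.

End scheffe.

(** * Hoeffding's inequality for empirical frequencies *)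

Section concentration.
Context {d : measure_display} {T : measurableType d} {R : realType}.
Variables (P : probability T R) (A : set T).
Hypothesis mA : measurable A.

Let hits n (x : n.-tuple T) : R := \sum_(i < n) \1_A (tnth x i).

Let hits_cons n (z : T * n.-tuple T) : hits (tuple_cons z) = \1_A z.1 + hits z.2.
Proof.
rewrite /hits big_ord_recl tnth0; congr (_ + _).
by apply: eq_bigr => i _; rewrite tnthS.
Qed.

Let measurable_hits n : measurable_fun [set: n.-tuple T] (@hits n).
Proof.
apply: measurable_sum => i.
apply: measurableT_comp; first exact: measurable_indic.
exact: measurable_tnth.
Qed.

Let measurable_hits_ge n a : measurable [set x : n.-tuple T | a <= hits x].
Proof.
rewrite -[X in measurable X]setTI.
by apply: measurable_fun_le => //; exact: measurable_hits.
Qed.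

(** Conditioning on the first observation, which lies in [A] or not, reduces the
tail for n + 1 observations to the tails at a - 1 and at a for n of them, and
the bound obeys the same recursion with equality.  This replaces the usual
integration of exp(l * hits) against the product law. *)
Lemma chernoff_hits n (a l : R) : 0 <= l ->
  (iid_law P n [set x | a <= hits x]%R <=
   (expR (- (l * a)) * (1 - fine (P A) + fine (P A) * expR l) ^+ n)%:E)%E.
Proof.
move=> l0; elim: n a => [|n IH] a.
  rewrite /= diracE expr0 mulr1.
  have [a0|a0] := leP a 0.
    rewrite (le_trans (y := 1%E))//; first by case: (_ \in _).
    by rewrite lee_fin -expR0 ler_expR oppr_ge0 mulr_ge0_le0.
  rewrite memNset; first by rewrite lee_fin expR_ge0.
  by rewrite /= /hits big_ord0; apply/negP; rewrite -ltNge.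
have -> : iid_law P n.+1 [set x | a <= hits x] =
    (P \x iid_law P n)%E
      ((A `*` [set x | a - 1 <= hits x]%R) `|` (~` A `*` [set x | a <= hits x]%R)).
  rewrite /= /distribution /pushforward; congr (_ _).
  apply/seteqP; split => [z|z]; rewrite /preimage/= hits_cons indicE.
    have [/set_mem zA h|/negP zA h] := boolP (z.1 \in A).
      by left; split => //; rewrite lerBlDl.
    by right; split; [move=> /mem_set|rewrite add0r in h].
  move=> [[zA]|[zA]].
    by rewrite (mem_set zA) lerBlDl.
  by rewrite (memNset zA) add0r.
have mAc := measurableC mA.
have m1 := measurableX mA (@measurable_hits_ge n (a - 1)).
have m2 := measurableX mAc (@measurable_hits_ge n a).
apply: (@le_trans _ _ (P A * iid_law P n [set x | a - 1 <= hits x]%R +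
                       P (~` A) * iid_law P n [set x | a <= hits x]%R)%E).
  rewrite -(product_measure1E _ (iid_law P n) mA (@measurable_hits_ge n (a - 1))).
  rewrite -(product_measure1E _ (iid_law P n) mAc (@measurable_hits_ge n a)).
  exact: measureU2.
have pA0 := prob_ge0 P A; have pA1 := prob_le1 P mA.
rewrite probability_setC// (probE P mA) -EFinB.
apply: (le_trans (leeD (lee_wpmul2l _ (IH _)) (lee_wpmul2l _ (IH _)))).
- by rewrite lee_fin.
- by rewrite lee_fin subr_ge0.
rewrite -!EFinM -EFinD lee_fin exprS mulrBr mulr1 opprB addrC.
by rewrite expRD le_eqVlt; apply/orP; left; apply/eqP; ring.
Qed.

Lemma hoeffding_upper n (t : R) : (0 < n)%N -> 0 <= t ->
  (iid_law P n [set x | fine (P A) + t <= empirical x A]%R <=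
   (expR (- (2 * n%:R * t ^+ 2)))%:E)%E.
Proof.
move=> n0 t0.
have nR : 0 < n%:R :> R by rewrite ltr0n.
have pA0 := prob_ge0 P A; have pA1 := prob_le1 P mA.
have -> : [set x : n.-tuple T | fine (P A) + t <= empirical x A] =
    [set x | n%:R * (fine (P A) + t) <= hits x].
  by apply/seteqP; split => x /=; rewrite /empirical ler_pdivlMl.
(* l = 4 t minimizes the exponent - l t + l^2 / 8, with minimum - 2 t^2 *)
apply: (le_trans (@chernoff_hits n _ (4 * t) _)); first by rewrite mulr_ge0.
rewrite lee_fin.
apply: (@le_trans _ _ (expR (- (4 * t * (n%:R * (fine (P A) + t)))) *
    expR (4 * t * fine (P A) + (4 * t) ^+ 2 / 8) ^+ n)).
  rewrite ler_wpM2l ?expR_ge0// lerXn2r ?nnegrE ?expR_ge0//.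
    by rewrite ltW// bernoulli_mgf_gt0// pA0.
  by rewrite bernoulli_mgf_le ?pA0// mulr_ge0.
rewrite -expRM_natl -expRD ler_expR le_eqVlt; apply/orP; left; apply/eqP.
by field.
Qed.

End concentration.

Section deviation.
Context {d : measure_display} {T : measurableType d} {R : realType}.

Lemma empiricalC n (x : n.-tuple T) (A : set T) : (0 < n)%N ->
  empirical x (~` A) = 1 - empirical x A :> R.
Proof.
move=> n0; rewrite /empirical.
have -> : \sum_(i < n) \1_(~` A) (tnth x i) =
    n%:R - \sum_(i < n) \1_A (tnth x i) :> R.
  rewrite -[X in X%:R](card_ord n) -sumr_const -sumrB; apply: eq_bigr => i _.
  by rewrite !indicE in_setC; case: (_ \in _) => /=; rewrite ?subrr ?subr0.
by rewrite mulrBr mulVf// pnatr_eq0 -lt0n.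
Qed.

Lemma measurable_empirical n A : measurable A ->
  measurable_fun [set: n.-tuple T] (fun x => empirical x A : R).
Proof.
move=> mA; apply: measurable_funM => //; apply: measurable_sum => i.
apply: measurableT_comp; first exact: measurable_indic.
exact: measurable_tnth.
Qed.

Lemma measurable_deviation n A (a t : R) : measurable A ->
  measurable [set x : n.-tuple T | t < `|empirical x A - a|].
Proof.
move=> mA.
have mf : measurable_fun [set: n.-tuple T] (fun x => `|empirical x A - a|).
  apply: measurableT_comp => //.
  by apply: measurable_funB => //; exact: measurable_empirical.
exact: measurable_fun_lt_set (measurable_cst t) mf.
Qed.

(** A lower deviation for [A] is an upper deviation for its complement. *)
Lemma hoeffding (P : probability T R) n A (t : R) : measurable A ->
  (0 < n)%N -> 0 <= t ->
  (iid_law P n [set x | t < `|empirical x A - fine (P A)|%R]%R <=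
   (2 * expR (- (2 * n%:R * t ^+ 2)))%:E)%E.
Proof.
move=> mA n0 t0.
have mge B : measurable B ->
    measurable [set x : n.-tuple T | fine (P B) + t <= empirical x B].
  move=> mB; rewrite -[X in measurable X]setTI.
  by apply: measurable_fun_le => //; exact: measurable_empirical.
have mAc : measurable (~` A) by exact: measurableC.
apply: (@le_trans _ _ (iid_law P n
  ([set x | fine (P A) + t <= empirical x A] `|`
   [set x | fine (P (~` A)) + t <= empirical x (~` A)]))).
  apply: le_measure; rewrite ?inE.
  - exact: measurable_deviation.
  - by apply: measurableU; exact: mge.
  move=> x /=; rewrite ltr_normr/= => /orP[h|h]; [left|right]; first by lra.
  by rewrite empiricalC// probC//; lra.
apply: (le_trans (measureU2 _ (mge _ mA) (mge _ mAc))).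
rewrite mulr_natl mulr2n EFinD.
have h1 := hoeffding_upper P mA n0 t0.
have h2 := hoeffding_upper P mAc n0 t0.
exact: leeD h1 h2.
Qed.

End deviation.

(** * The tournament on a sample with accurate frequencies *)

Section tournament_deterministic.
Context {d : measure_display} {T : measurableType d} {R : realType} {Theta : Type}.
Variables (mu : {measure set T -> \bar R}).
Variables (P : Theta -> probability T R) (p : Theta -> T -> R).
Hypothesis p_density : forall theta, is_density mu (P theta) (p theta).
Variables (m : nat) (c : 'I_m -> Theta) (n : nat) (x : n.-tuple T).
Variables (j0 : 'I_m) (r : R).
Hypothesis r_ge0 : 0 <= r.
Hypothesis near_j0 : forall j k,
  `|empirical x (test_set p (c j) (c k)) -
    fine (P (c j0) (test_set p (c j) (c k)))| <= r.

Let mS j k : measurable (test_set p (c j) (c k)).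
Proof. exact: measurable_density_lt (p_density _) (p_density _). Qed.

(** The observed frequency of the Scheffe set is within r of the probability
given to it by j0; if k explains it even better, then j0 and k differ by at
most 2 r on this set, which realizes their distance. *)
Lemma phi_center_near k : phi P p c x j0 k -> TV (P (c k)) (P (c j0)) <= 2 * r.
Proof.
rewrite /phi => h; rewrite TVC.
apply: (le_trans (TV_scheffe (p_density _) (p_density _))).
have := near_j0 j0 k; move: h; rewrite /test_set.
set e := empirical _ _; set a := fine _; set b := fine _ => eb ea.
have := lt_le_trans eb ea.
by move: ea; rewrite ler_norml ltr_norml => /andP[? ?] /andP[? ?]; lra.
Qed.

(** On the Scheffe set of j and k the observed frequency is within r + 2 r of the
probability given by k, while j and k differ there by more than 8 r - 2 r; the
probability given by j is thus farther than 3 r from the frequency. *)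
Lemma phi_far_near j k : 8 * r < TV (P (c j)) (P (c j0)) ->
  TV (P (c k)) (P (c j0)) <= 2 * r -> phi P p c x j k.
Proof.
move=> far near; rewrite /phi.
have tri := TV_triangle (P (c j)) (P (c k)) (P (c j0)).
have := le_trans tri (lerD (TV_scheffe (p_density (c j)) (p_density (c k))) near).
have := near_j0 j k.
have := TV_ge (P (c k)) (P (c j0)) (mS j k).
rewrite -/(test_set p (c j) (c k)).
set e := empirical _ _; set a := fine (P (c j) _); set b := fine (P (c k) _).
set z := fine _ => kz ez jk.
have ek : `|e - b| <= 3 * r.
  rewrite (le_trans (ler_distD z _ _))// (_ : 3 * r = r + 2 * r); last by ring.
  by rewrite lerD// distrC (le_trans kz).
apply: (le_lt_trans ek).
move: ek; rewrite ler_norml => /andP[? ?].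
by rewrite ltr_normr; apply/orP; right; lra.
Qed.

(** A centre j farther than 8 r would lose against every opponent that beats j0
([phi_center_near] and [phi_far_near]) and against j0 itself, so it would have
strictly more losses than j0. *)
Lemma TV_tournament j : (forall k, losses P p c x j <= losses P p c x k)%N ->
  TV (P (c j)) (P (c j0)) <= 8 * r.
Proof.
move=> minj; rewrite leNgt; apply/negP => far.
have near0 : TV (P (c j0)) (P (c j0)) <= 2 * r.
  by apply: TV_le => A _; rewrite subrr normr0 mulr_ge0.
have jk k : TV (P (c k)) (P (c j0)) <= 2 * r -> k != j.
  apply: contraTneq => ->; rewrite -ltNge.
  by rewrite (le_lt_trans _ far)// ler_wpM2r// ler_nat.
have := minj j0; rewrite leqNgt => /negP; apply.
rewrite /losses big_mkcond [ltnRHS]big_mkcond/=.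
(* the opponent j0 accounts for the strict inequality: it is not an opponent of
itself but it beats j *)
rewrite (bigD1 j0)//= eqxx add0n [ltnRHS](bigD1 j0)//= jk// phi_far_near//.
rewrite add1n ltnS; apply: leq_sum => k kj0; rewrite kj0.
case: (boolP (phi P p c x j0 k)) => // /phi_center_near kn.
by rewrite jk// phi_far_near.
Qed.

End tournament_deterministic.

(** * The risk bound *)

Lemma measure_bigcup_fin_le d (T : ringOfSetsType d) (R : realFieldType)
    (mu : {content set T -> \bar R}) (I : finType) (F : I -> set T) :
  (forall i, measurable (F i)) ->
  (mu (\bigcup_(i in [set: I]) F i) <= \sum_(i : I) mu (F i))%E.
Proof.
move=> mF.
have -> : \bigcup_(i in [set: I]) F i = \bigcup_(i in [set` index_enum I]) F i.
  by apply: eq_bigcupl; split => i _ //=; rewrite mem_index_enum.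
rewrite bigcup_seq; elim: (index_enum I) => [|i s IH].
  by rewrite !big_nil measure0.
rewrite !big_cons; apply: (le_trans (measureU2 _ _ _)) => //.
  exact: bigsetU_measurable.
exact: leeD2l.
Qed.

Theorem theorem3p1 (R : realType) (d : measure_display) (T : measurableType d)
    (mu : {measure set T -> \bar R}) (Theta : Type)
    (P : Theta -> probability T R) (p : Theta -> T -> R)
    (p_density : forall theta, is_density mu (P theta) (p theta))
    (P_totally_bounded : TV_totally_bounded P)
    (eps : {i01 R}) (delta eta : R) (delta_gt0 : 0 < delta)
    (m : nat) (c : 'I_m -> Theta)
    (m_covering_number : m = covering_number P delta)
    (c_covering : is_covering P delta c)
    (n : nat) (n_gt0 : (0 < n)%N)
    (jhat : n.-tuple T -> 'I_m) (jhat_tournament : is_tournament P p c jhat)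
    (eta_gt : eta > 8 * (eps%:num + delta)) :
  (ereal_sup [set iid_law (contamination eps (P theta) Q) n
                    [set x | TV (P (c (jhat x))) (P theta) > eta + delta]%R
             | theta in [set: Theta] & Q in [set: probability T R]]
   <= (4 * (covering_number P delta)%:R ^+ 2
       * expR (- 2^-1 * n%:R * (eta / 4 - 2 * (eps%:num + delta)) ^+ 2))%R%:E)%E.
Proof.
apply: ge_ereal_sup => _ [theta _ [Q _ <-]].
rewrite -m_covering_number.
have [j0 j0P] := c_covering theta.
have [mjhat jhat_min] := jhat_tournament.
pose S (jk : 'I_m * 'I_m) := test_set p (c jk.1) (c jk.2).
have mS jk : measurable (S jk) := measurable_density_lt (p_density _) (p_density _).
pose t : R := eta / 8 - (eps%:num + delta).
have t0 : 0 <= t by rewrite /t; lra.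
pose X := contamination eps (P theta) Q.
pose bad jk := [set x : n.-tuple T | t < `|empirical x (S jk) - fine (X (S jk))|].
have mbad jk : measurable (bad jk) by exact: measurable_deviation.
have mbads : measurable (\bigcup_(jk in [set: 'I_m * 'I_m]) bad jk).
  by apply: fin_bigcup_measurable => //; exact: finite_finset.
apply: (@le_trans _ _ (iid_law X n (\bigcup_(jk in [set: 'I_m * 'I_m]) bad jk))).
  apply: le_measure; rewrite ?inE//.
    pose far := [set j | eta + delta < TV (P (c j)) (P theta)].
    rewrite [X in measurable X](_ : _ = \bigcup_(j in far) jhat @^-1` [set j]).
      by apply: fin_bigcup_measurable => //; exact: finite_finset.
    by apply/seteqP; split => [x xfar|x [j jfar /= ->//]]; exists (jhat x).
  move=> x /= xfar; apply: contrapT => good.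
  have := TV_triangle (P (c (jhat x))) (P (c j0)) (P theta).
  apply/negP; rewrite -ltNge; apply: le_lt_trans xfar; apply: lerD => //.
  (* here r = eta / 8, which is t + eps + delta *)
  rewrite (_ : eta = 8 * (eta / 8)); last by field.
  apply: (TV_tournament p_density) (jhat_min x) => [|j k].
    by have : 0 <= eps%:num :> R by []; lra.
  have dev : `|empirical x (S (j, k)) - fine (X (S (j, k)))| <= t.
    by rewrite leNgt; apply/negP => jk; apply: good; exists (j, k).
  have contam :=
    le_trans (TV_ge X (P theta) (mS (j, k))) (TV_contamination eps (P theta) Q).
  have cover := le_trans (TV_ge (P (c j0)) (P theta) (mS (j, k))) j0P.
  change (test_set p (c j) (c k)) with (S (j, k)).
  move: dev contam cover; rewrite !ler_norml /t.
  move: (fine (X _)) (fine (P theta _)) (fine (P (c j0) _)) (empirical _ _).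
  move=> ? ? ? ? /andP[? ?] /andP[? ?] /andP[? ?].
  by apply/andP; split; lra.
apply: (le_trans (measure_bigcup_fin_le _ mbad)).
apply: (le_trans (lee_sum _ (fun jk _ => hoeffding X (mS jk) n_gt0 t0))).
rewrite sumEFin lee_fin sumr_const card_prod card_ord.
rewrite -[X in X <= _]mulr_natl natrM -expr2.
have -> : - (2 * n%:R * t ^+ 2) =
    - 2^-1 * n%:R * (eta / 4 - 2 * (eps%:num + delta)) ^+ 2.
  by rewrite /t; field.
set E := expR _; have E0 : 0 <= E by exact: expR_ge0.
rewrite mulrA ler_wpM2r// mulrC ler_wpM2r ?exprn_ge0//; lra.
Qed.
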